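(* Let $s\geq 3$ be an odd integer. Then (i) if $m\geq 2$ is even and $n\geq \frac{sm}{2}(sm-2)$, then $R(P_n,J_{s,m})=2n-1$; (ii) if $m\geq 3$ is odd and $n\geq \frac{sm-1}{2}(sm-1)$, then $R(P_n,J_{s,m})=2n$.
   Context: All graphs are finite and simple. For graphs $G$ and $H$, the Ramsey number $R(G,H)$ is the least natural number $N$ such that for every graph $F$ on $N$ vertices, either $F$ contains $G$ as a subgraph or the complement $\overline{F}$ contains $H$ as a subgraph. $P_n$ denotes the path on $n$ vertices. For integers $s,m\geq 2$, the generalized Jahangir graph $J_{s,m}$ is the graph on $sm+1$ vertices consisting of a cycle $C_{sm}=v_1v_2\cdots v_{sm}v_1$ together with one additional vertex adjacent to exactly the $m$ cycle vertices $v_1, v_{s+1}, v_{2s+1},\ldots,v_{(m-1)s+1}$ (i.e., $m$ vertices of the cycle at distance $s$ from each other along the cycle). *)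

(* Defs.v *)
From mathcomp Require Import all_boot.
Set Implicit Arguments. Unset Strict Implicit. Unset Printing Implicit Defensive.

Definition simple_graph (T : finType) (e : rel T) : Prop :=
  (forall x y, e x y = e y x) /\ (forall x, e x x = false).

Definition compl_graph (T : finType) (e : rel T) : rel T :=
  fun x y => (x != y) && ~~ e x y.

Definition contains_subgraph (T : finType) (e : rel T) (U : finType) (f : rel U) : Prop :=
  exists phi : T -> U, injective phi /\ (forall x y, e x y -> f (phi x) (phi y)).

Definition ramsey_prop (T1 : finType) (g : rel T1) (T2 : finType) (h : rel T2)
    (N : nat) : Prop :=
  forall f : rel 'I_N, simple_graph f ->
    contains_subgraph g f \/ contains_subgraph h (compl_graph f).

Definition is_ramsey_number (T1 : finType) (g : rel T1) (T2 : finType) (h : rel T2)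
    (N : nat) : Prop :=
  ramsey_prop g h N /\ (forall M, ramsey_prop g h M -> N <= M).

Definition path_graph (n : nat) : rel 'I_n :=
  fun i j => (i.+1 == j :> nat) || (j.+1 == i :> nat).

(* Generalized Jahangir graph J_{s,m}: vertices None (the extra vertex) and
   Some k, k < s*m, where Some k stands for cycle vertex v_{k+1}.  The cycle is
   v_1 v_2 ... v_{sm} v_1, and the extra vertex is adjacent to v_{js+1},
   i.e. to Some k with s %| k. *)
Definition jahangir (s m : nat) : rel (option 'I_(s * m)) :=
  fun x y =>
    match x, y with
    | Some i, Some j => (i.+1 %% (s * m) == j) || (j.+1 %% (s * m) == i)
    | None, Some j => s %| j
    | Some i, None => s %| i
    | None, None => false
    end.

Arguments path_graph n : clear implicits.
Arguments jahangir s m : clear implicits.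

(* Main.v *)
Require Import Defs.
From mathcomp Require Import all_boot.
From mathcomp Require Import zify.

Set Implicit Arguments. Unset Strict Implicit. Unset Printing Implicit Defensive.

(** Let k = sm, t = floor(k/2) and c = k mod 2, so that the claim is
    R(P_n, J_{s,m}) = 2n - 1 + c; it holds as soon as n >= 4t.

    Lower bound: in the disjoint union of two cliques K_{n-1} and c isolated
    vertices there is no P_n.  The complement is bipartite after removal of at
    most c vertices, whereas J_{s,m} has an odd cycle through the hub over every
    sector of s + 1 cycle vertices; for odd k the rim is odd as well and, as
    m >= 3, no single vertex meets the rim and all the sectors.

    Upper bound: J_{s,m} embeds into the complement once there are t-sets A, B
    and a vertex z with no edges between any two of A, B, z, and, for odd k, a
    further vertex w missing one vertex of A and one of B.  Let L1 be a longest
    path and L2 a longest path in the rest.  If L2 has at least 2t vertices, the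
    first t and the last t vertices of L1 have no neighbour on L2, and a vertex
    z off both paths misses at least half of them and half of L2, because it is
    never adjacent to two consecutive vertices; w is any other remaining vertex,
    as it misses the ends of L1 and L2.  If L2 is shorter, depth-first search in
    the rest, which has at least n vertices, yields A and B, and the ends of L1
    serve as z and w. *)

(** * Sequences in which a predicate never holds at two consecutive places *)

Lemma sorted_of_splits (T : Type) (r : rel T) p :
  (forall p1 x y p2, p = p1 ++ [:: x, y & p2] -> r x y) -> sorted r p.
Proof.
elim: p => // x [|y p] IH //= H; rewrite (H [::] x y p) //=.
by apply: IH => p1 u v p2 E; apply: (H (x :: p1) u v p2); rewrite E.
Qed.

(** Each entry satisfying [a] has a predecessor, and that one fails [a]; pairing the two gives the
    bound. *)
Lemma size_le_double_count_predC (T : Type) (a : pred T) s :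
  sorted (fun x y => ~~ (a x && a y)) s -> (if s is x :: _ then ~~ a x else true) ->
  size s <= (count (predC a) s).*2.
Proof.
have [n] := ubnP (size s); elim: n s => // n IH [|x [|y s]] //=.
  by move=> _ _ ->.
rewrite ltnS => ltn /andP[axy sys] nax; rewrite nax /=.
case: (boolP (a y)) => ay /=.
  have := IH s; case: s sys ltn => // z s /= /andP[ayz szs] ltn IHs.
  rewrite ay /= in ayz.
  by have := IHs _ szs ayz; lia.
by have := IH (y :: s) ltn sys ay; rewrite /= ay; lia.
Qed.

(** * Longest paths and depth-first search *)

Section PathsInGraph.

Variables (T : finType) (e : rel T).
Hypothesis e_sym : symmetric e.
Implicit Types (S D : {set T}) (p q : seq T) (x y z : T).

Definition path_in S p := [&& sorted e p, uniq p & all [in S] p].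

Definition longest_path S p :=
  path_in S p /\ forall q, path_in S q -> size q <= size p.

Lemma path_in_size S p : path_in S p -> size p <= #|S|.
Proof.
case/and3P=> _ /card_uniqP <- /allP pS.
exact/subset_leq_card/subsetP.
Qed.

Lemma longest_path_exists S : exists p, longest_path S p.
Proof.
pose P l := [exists p : l.-tuple T, path_in S p].
have P0 : exists l, P l by exists 0; apply/existsP; exists [tuple].
have Pmax l : P l -> l <= #|S|.
  by case/existsP=> p /path_in_size; rewrite size_tuple.
case: (ex_maxnP P0 Pmax) => l /existsP[p pP] lmax.
exists p; split=> // q qP; rewrite size_tuple; apply: lmax.
by apply/existsP; exists (in_tuple q).
Qed.

Lemma path_in_rev S p : path_in S (rev p) = path_in S p.
Proof.
rewrite /path_in rev_sorted rev_uniq all_rev.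
by congr (_ && _); apply: eq_sorted => x y; rewrite e_sym.
Qed.

Lemma longest_path_rev S p : longest_path S p -> longest_path S (rev p).
Proof.
by case=> pP pmax; split; rewrite ?path_in_rev // => q /pmax; rewrite size_rev.
Qed.

(** Otherwise [z] could be put in front of the path. *)
Lemma longest_path_endpoint S x p z :
  longest_path S (x :: p) -> z \in S -> z \notin x :: p -> ~~ e x z.
Proof.
case=> /and3P[srt unq inS] pmax zS zp; apply/negP=> exz.
have /pmax : path_in S (z :: x :: p); last by rewrite /= ltnn.
by rewrite /path_in /= e_sym exz zS zp; apply/and3P.
Qed.

(** Otherwise [z] could be inserted between two consecutive neighbours. *)
Lemma longest_path_no_insertion S p z :
  longest_path S p -> z \in S -> z \notin p ->
  sorted (fun x y => ~~ (e z x && e z y)) p.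
Proof.
case=> /and3P[srt unq inS] pmax zS zp; apply: sorted_of_splits => p1 x y p2 Ep.
apply/negP=> /andP[ezx ezy].
have /pmax : path_in S (p1 ++ [:: x, z, y & p2]); last first.
  by rewrite Ep !size_cat /= !addnS ltnn.
have permp : perm_eq (p1 ++ [:: x, z, y & p2]) (z :: p).
  by apply/permP => a; rewrite Ep /= !count_cat /=; lia.
apply/and3P; split; last 2 first.
- by rewrite (perm_uniq permp) /= zp.
- by rewrite (perm_all _ permp) /= zS.
move: srt; rewrite Ep !sorted_cat_cons /= => /and3P[-> _ ->].
by rewrite e_sym ezx ezy.
Qed.

Lemma count_non_nbr_take S p z k :
  longest_path S p -> z \in S -> z \notin p -> k <= size p ->
  k <= (count (predC (e z)) (take k p)).*2.
Proof.
move=> pmax zS zp kp; rewrite -{1}(size_takel kp).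
apply: size_le_double_count_predC.
  exact/take_sorted/(longest_path_no_insertion pmax).
case: p pmax zp {kp} => // x p pmax zp; case: k => //= k.
by rewrite e_sym; apply: longest_path_endpoint pmax zS zp.
Qed.

(* An edge [x y] with [x] among the first [t] vertices of [p] would let the
   longer half of [q] replace the part of [p] before [x]. *)
Lemma longest_path_initial_segment S p q t x y :
  longest_path S p -> path_in S q -> ~~ has [in p] q -> t.*2 <= size q ->
  x \in take t p -> y \in q -> ~~ e x y.
Proof.
move=> [/and3P[srt unq inS] pmax] + + + xp.
have [p1 [p2 [Ep ltp1]]] : exists p1 p2, p = p1 ++ x :: p2 /\ size p1 < t.
  case/splitPr Et: _ / xp => [p1 p2].
  exists p1, (p2 ++ drop t p); rewrite -cat_cons catA -Et cat_take_drop; split=> //.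
  have := size_take_min t p; rewrite Et size_cat /=; lia.
(* It suffices that [q] has at least [t] vertices up to and including [y]; if not, [rev q] has. As
   [p1] has fewer than [t] vertices, the exchange lengthens [p]. *)
suff half q1 q2 : path_in S (q1 ++ y :: q2) -> ~~ has [in p] (q1 ++ y :: q2) ->
    t <= (size q1).+1 -> ~~ e x y.
  move=> qP dis tq yq.
  have [q1 [q2 Eq]] : exists q1 q2, q = q1 ++ y :: q2.
    by case/splitPr: yq => q1 q2; exists q1, q2.
  move: qP dis tq; rewrite Eq size_cat /= => qP dis tq.
  case: (leqP t (size q1).+1) => tq1.
    exact: half qP dis tq1.
  apply: (half (rev q2) (rev q1)).
  - by rewrite -cat_rcons -rev_cons -rev_cat path_in_rev.
  - by rewrite -cat_rcons -rev_cons -rev_cat has_rev.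
  - by rewrite size_rev; lia.
case/and3P=> srtq unqq inSq dis tq1; apply/negP=> exy.
have /pmax : path_in S (rcons q1 y ++ x :: p2); last first.
  by rewrite Ep !size_cat size_rcons /=; lia.
move: srtq srt; rewrite Ep !sorted_cat_cons => /andP[sq _] /andP[_ sp].
move: dis unqq unq inSq inS; rewrite -cat_rcons Ep !cat_uniq !all_cat has_cat.
case/norP=> dis1 _ /andP[uq _] /and3P[_ _ up] /andP[aq _] /andP[_ ap].
apply/and3P; split.
- case: (q1) sq => [|u q1'] /=; first by rewrite sp e_sym exy.
  by move=> sq; rewrite cat_path last_rcons sq /= e_sym exy.
- rewrite cat_uniq uq up andbT; apply/hasPn => u up2.
  by apply/negP=> uq1; case/hasP: dis1; exists u; rewrite //= mem_cat up2 orbT.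
- by rewrite all_cat aq ap.
Qed.

(* Depth-first search: [p] is the stack, [D] the set of finished vertices. *)
Lemma dfs_separation S d :
  d <= #|S| -> exists D p, [/\ path_in S p, D \subset S, #|D| = d,
    ~~ has [in D] p &
    forall x y, x \in D -> y \in S -> y \notin D -> y \notin p -> ~~ e x y].
Proof.
elim: d => [|d IH] ltd.
  exists set0, [::]; split; rewrite ?sub0set ?cards0 //.
  by move=> x y; rewrite inE.
have [D [p [pP sDS cD dis sep]]] := IH (ltnW ltd).
have [k] := ubnP (#|S| - size p); elim: k p pP dis sep => // k IHk p pP dis sep.
(* An unvisited vertex may be pushed if it is adjacent to the top of the stack; on an empty stack
   any unvisited vertex may. *)
move=> ltk; pose push y :=
  [&& y \in S, y \notin D, y \notin p & if p is x :: _ then e x y else true].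
case: (pickP push) => [y /and4P[yS yD yp exy] | nopush].
  have pP' : path_in S (y :: p).
    case/and3P: pP => srt unq inS; rewrite /path_in /= yp unq yS inS !andbT.
    by case: (p) exy srt => //= x p'; rewrite e_sym => ->.
  apply: (IHk (y :: p)) => //.
  - by rewrite /= negb_or yD.
  - by move=> u v uD vS vD; rewrite inE => /norP[_]; apply: sep.
  - by have := path_in_size pP'; move: ltk => /=; lia.
case: p => [|x p] in pP dis sep ltk push nopush *.
  have [y /setDP[yS yD]] : exists y, y \in S :\: D.
    apply/set0Pn; rewrite -card_gt0 cardsD (setIidPr sDS) cD; lia.
  by have := nopush y; rewrite /push yS yD.
case/and3P: pP => srt /= /andP[xp unq] /andP[xS inS].
case/norP: dis => xD dis.
(* Nothing can be pushed, so the top [x] has no unvisited neighbour and may be counted as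
   finished. *)
exists (x |: D), p; split.
- by rewrite /path_in unq inS !andbT; apply: path_sorted srt.
- by rewrite subUset sub1set xS.
- by rewrite cardsU1 xD cD.
- apply/hasPn=> y yp; rewrite /= !inE negb_or (hasPn dis) // andbT.
  by apply: contraNneq xp => <-.
- move=> u v; rewrite !inE negb_or => uxD vS /andP[vx vD] vp.
  case/orP: uxD => [/eqP-> | uD]; last first.
    by apply: sep; rewrite // inE (negPf vx).
  by have := nopush v; rewrite /push vS vD inE (negPf vx) vp /= => ->.
Qed.

End PathsInGraph.

(** * Separated sets, according to the length of the second path *)

Section Separation.

Variables (T : finType) (e : rel T).
Hypothesis e_sym : symmetric e.
Implicit Types (S D : {set T}) (p q : seq T) (x y z : T).

Lemma path_in_subset S S' p : S \subset S' -> path_in e S p -> path_in e S' p.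
Proof.
move=> sSS' /and3P[srt unq inS]; apply/and3P; split=> //.
by apply: sub_all inS => x /(subsetP sSS').
Qed.

Lemma uniq_take_cat_take_rev t p :
  uniq p -> t.*2 <= size p -> uniq (take t p ++ take t (rev p)).
Proof.
move=> unq tp; rewrite take_rev cat_uniq rev_uniq take_uniq // drop_uniq //.
rewrite andbT has_rev /=; apply/hasPn=> x xd; apply/negP=> /= xt.
have: uniq (take t p ++ drop t p) by rewrite cat_take_drop.
rewrite cat_uniq => /and3P[_ /hasPn/(_ x) dis _]; rewrite /= xt in dis.
apply: notF; apply: dis; move: xd; have -> : size p - t = (size p - t.*2) + t by lia.
by rewrite -drop_drop; apply: mem_drop.
Qed.

(** [A] is chosen among the [2t] vertices near the ends of [p], and [B] in [q]; [z] misses at least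
    half of either supply, hence at least [t] vertices of each. *)
Lemma long_paths_separated p q t z :
  0 < t -> longest_path e setT p -> longest_path e (~: [set x in p]) q ->
  t.*2 <= size q -> z \notin p -> z \notin q ->
  exists A B, [/\ [/\ size A = t, size B = t, uniq A & uniq B],
    {subset A <= p}, {subset B <= q},
    (forall x, x \in A ++ B -> ~~ e z x) /\
    (forall x y, x \in A -> y \in B -> ~~ e x y) &
    forall w, w \notin p -> w \notin q ->
      ~~ e w (head z A) /\ ~~ e w (last z B)].
Proof.
move=> t0 pmax qmax tq zp zq; set S := ~: _ in qmax.
have inS w : w \notin p -> w \in S by rewrite !inE.
have qT : path_in e setT q by apply: path_in_subset (proj1 qmax); apply: subsetT.
have tp : t.*2 <= size p by apply: leq_trans tq _; apply: (proj2 pmax).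
have dis : ~~ has [in p] q.
  apply/hasPn=> x xq; case/and3P: (proj1 qmax) => _ _ /allP/(_ x xq).
  by rewrite !inE.
pose C := take t p ++ take t (rev p).
pose A := take t [seq x <- C | ~~ e z x].
pose B := take t [seq x <- q | ~~ e z x].
have cnt s : size [seq x <- s | ~~ e z x] = count (predC (e z)) s.
  by rewrite size_filter.
have sAC x : x \in A -> x \in C /\ ~~ e z x.
  by move=> /mem_take; rewrite mem_filter => /andP[].
have sBq x : x \in B -> x \in q /\ ~~ e z x.
  by move=> /mem_take; rewrite mem_filter => /andP[].
have sCp x : x \in C -> x \in p.
  by rewrite mem_cat => /orP[/mem_take | /mem_take]; rewrite ?mem_rev.
have [/and3P[_ unqp _] _] := pmax; have [/and3P[_ unqq _] _] := qmax.
(* The first vertices of [p] and [q] are missed by [z], so they survive the filter. Reversal makes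
   them the head of [A] and the last entry of the second list, where the endpoint argument applies
   to every [w]. *)
exists A, (rev B); split; first split.
- have tp' : t <= size p by lia.
  rewrite size_takel // cnt count_cat.
  have := count_non_nbr_take e_sym pmax (in_setT z) zp tp'.
  have := count_non_nbr_take e_sym (longest_path_rev e_sym pmax) (in_setT z).
  rewrite mem_rev size_rev => /(_ _ zp tp').
  by lia.
- rewrite size_rev size_takel // cnt.
  have := count_non_nbr_take e_sym qmax (inS _ zp) zq (leqnn _).
  by rewrite take_size; lia.
- by rewrite take_uniq // filter_uniq // uniq_take_cat_take_rev.
- by rewrite rev_uniq take_uniq // filter_uniq.
- by move=> x /sAC[/sCp].
- by move=> x; rewrite mem_rev => /sBq[].
- split=> x.
    by rewrite mem_cat mem_rev => /orP[/sAC[] | /sBq[]].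
  move=> y /sAC[xC _]; rewrite mem_rev => /sBq[yq _].
  move: xC; rewrite mem_cat => /orP[] xC.
    exact: (longest_path_initial_segment e_sym pmax qT dis tq xC).
  have pmax' := longest_path_rev e_sym pmax.
  apply: (longest_path_initial_segment e_sym pmax' qT _ tq xC) => //.
  by rewrite (eq_has (a2 := [in p])) // => v; rewrite /= mem_rev.
- move=> w wp wq; split.
    have [x [p' Ep]] : exists x p', p = x :: p'.
      by case: (p) tp => [|x p'] /=; [lia | exists x, p'].
    rewrite Ep in pmax wp zp; have nzx : ~~ e z x.
      by rewrite e_sym; apply: longest_path_endpoint pmax _ zp.
    rewrite /A /C Ep; case: (t) t0 => //= t' _; rewrite nzx /= e_sym.
    exact: longest_path_endpoint pmax _ wp.
  have [y [q' Eq]] : exists y q', q = y :: q'.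
    by case: (q) tq => [|x p'] /=; [lia | exists x, p'].
  rewrite Eq in qmax wq zq; have nzy : ~~ e z y.
    by rewrite e_sym; apply: longest_path_endpoint qmax _ zq => //; apply: inS.
  rewrite /B Eq; case: (t) t0 => //= t' _; rewrite nzy /= rev_cons last_rcons e_sym.
  by apply: longest_path_endpoint qmax _ wq => //; apply: inS.
Qed.

(** The search stops with [t] finished vertices, which form [A]. Its stack is a path off [p], so it
    has fewer than [2t] vertices, and more than [t] unvisited ones remain to supply [B]. The ends of
    [p] have no neighbour off [p]. *)
Lemma short_paths_separated p t :
  0 < t -> longest_path e setT p ->
  (forall q, path_in e (~: [set x in p]) q -> size q < t.*2) ->
  4 * t <= #|~: [set x in p]| -> 0 < size p ->
  exists z w A B, [/\ [/\ size A = t, size B = t & uniq (z :: A ++ B)],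
    forall x, x \in A ++ B -> ~~ e z x,
    forall x y, x \in A -> y \in B -> ~~ e x y,
    w \notin z :: A ++ B & forall x, x \in A ++ B -> ~~ e w x].
Proof.
move=> t0 pmax short; set S := ~: _ => St p0.
have tS : t <= #|S| by lia.
have [D [r [rP sDS cD dis sep]]] := dfs_separation e_sym tS.
have rt := short _ rP.
pose U := S :\: D :\: [set x in r].
have cU : t < #|U|.
  have rs : #|[set x in r]| <= size r by rewrite cardsE card_size.
  have := cardsD S D; have := cardsD (S :\: D) [set x in r].
  have := subset_leq_card (subsetIr S D).
  have := subset_leq_card (subsetIr (S :\: D) [set x in r]).
  rewrite -/U; lia.
have inU y : y \in U -> [/\ y \in S, y \notin D & y \notin r].
  by rewrite !inE => /and3P[].
have [x [p' Ep]] : exists x p', p = x :: p'.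
  by case: (p) p0 => // x p' _; exists x, p'.
pose A := enum D; pose B := take t (enum U).
have AB y : y \in A ++ B -> y \in S.
  rewrite mem_cat mem_enum => /orP[/(subsetP sDS) // | /mem_take].
  by rewrite mem_enum => /inU[].
have nS y : y \in p -> y \notin S by move=> yp; rewrite !inE negbK.
have xp : x \in p by rewrite Ep inE eqxx.
have endAB y : y \in A ++ B -> ~~ e x y /\ ~~ e (last x p') y.
  move/AB; rewrite !inE => yp; split.
    by move: pmax yp; rewrite Ep => /(longest_path_endpoint e_sym); apply.
  move: (longest_path_rev e_sym pmax); rewrite Ep lastI rev_rcons.
  move/(longest_path_endpoint e_sym); apply=> //.
  by rewrite -rev_rcons -lastI mem_rev -Ep.
have uB : uniq B by rewrite take_uniq // enum_uniq.
have disAB : ~~ has [in A] B.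
  apply/hasPn=> y /mem_take; rewrite mem_enum => /inU[_ yD _].
  by rewrite /= mem_enum.
have uAB : uniq (A ++ B) by rewrite cat_uniq uB disAB enum_uniq.
have sz : size A = t /\ size B = t.
  by rewrite size_takel -?cardE // ltnW.
have nAB y : y \in p -> y \notin A ++ B.
  by move=> yp; apply: contra (nS y yp); apply: AB.
have sepAB u v : u \in A -> v \in B -> ~~ e u v.
  rewrite mem_enum => uD /mem_take; rewrite mem_enum => /inU[*].
  exact: sep.
(* If [p] is a single vertex, its ends coincide. Then distinct vertices are never adjacent, and [w]
   can be the vertex of [U] listed just after those in [B]. *)
have [Ep' | p'0] := eqVneq p' [::].
  pose w := nth x (enum U) t.
  have wU : w \in U by rewrite -mem_enum mem_nth // -cardE.
  have [wS wD wr] := inU w wU.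
  have wAB : w \notin A ++ B.
    rewrite mem_cat mem_enum negb_or wD /=.
    have := enum_uniq U; rewrite -{1}(cat_take_drop t (enum U)) cat_uniq.
    case/and3P=> _ /hasPn/(_ w) + _; apply.
    by rewrite (drop_nth x) -?cardE // inE eqxx.
  exists x, w, A, B; split=> //.
  - by split; [case: sz | case: sz |]; rewrite //= uAB nAB.
  - by move=> y /endAB[].
  - rewrite inE negb_or wAB andbT.
    by apply: contraTneq wS => ->; apply: nS.
  - move=> y yAB; apply/negP => ewy.
    have /(proj2 pmax) : path_in e setT [:: w; y]; last by rewrite Ep Ep'.
    rewrite /path_in /= ewy !inE !andbT /=.
    by apply: contraNneq wAB => ->.
exists x, (last x p'), A, B; split=> //.
- by split; [case: sz | case: sz |]; rewrite //= uAB nAB.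
- by move=> y /endAB[].
- have lp : last x p' \in p by rewrite Ep mem_last.
  rewrite inE negb_or nAB // andbT.
  have [/and3P[_ + _] _] := pmax; rewrite Ep /= => /andP[xp' _].
  apply: contraNneq xp' => <-.
  by case: (p') p'0 => //= y p'' _; apply: mem_last.
- by move=> y /endAB[].
Qed.
(** At least [n + b] vertices lie off the longest path, enough for the search if the second path is
    short. Otherwise the two paths, each with fewer than [n] vertices, leave at least [1 + b]
    vertices for [z] and [w]. *)
Lemma separated_sets_of_no_path n t (b : bool) :
  0 < t -> 4 * t <= n -> #|T| = 2 * n - 1 + b ->
  (forall p, path_in e setT p -> size p < n) ->
  exists z w A B, [/\ [/\ size A = t, size B = t & uniq (z :: A ++ B)],
    forall x, x \in A ++ B -> ~~ e z x,
    forall x y, x \in A -> y \in B -> ~~ e x y &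
    b -> [/\ w \notin z :: A ++ B, ~~ e w (head z A) & ~~ e w (last z B)]].
Proof.
move=> t0 tn cT short.
have [p pmax] := longest_path_exists e setT.
have pn := short _ (proj1 pmax).
have [/and3P[_ unqp _] _] := pmax.
have cp : #|[set x in p]| = size p by rewrite cardsE; apply/card_uniqP.
set S := ~: [set x in p]; have cS : size p + #|S| = #|T| by rewrite -cp cardsC.
have [q qmax] := longest_path_exists e S.
have [/and3P[_ unqq /allP qS] _] := qmax.
have qp : size q <= size p.
  by apply: (proj2 pmax); apply: path_in_subset (proj1 qmax); apply: subsetT.
have p0 : 0 < size p.
  have /card_gt0P[x _] : 0 < #|T| by lia.
  by apply: (proj2 pmax [:: x]); rewrite /path_in /= in_setT.
case: (leqP t.*2 (size q)) => tq; last first.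
  have shortS r : path_in e S r -> size r < t.*2.
    by move=> /(proj2 qmax) rq; apply: leq_ltn_trans tq.
  have [|z [w [A [B [szAB zAB sepAB wAB weAB]]]]] :=
    short_paths_separated t0 pmax shortS _ p0; first by rewrite -/S; lia.
  exists z, w, A, B; split=> // _; case: szAB => szA szB _.
  split=> //; apply: weAB.
    by case: (A) szA => [|a A'] /= ?; [lia | rewrite inE eqxx].
  rewrite mem_cat; apply/orP; right.
  by case: (B) szB => [|a A'] /= ?; [lia | apply: mem_last].
pose R := S :\: [set x in q].
have cq : #|[set x in q]| = size q by rewrite cardsE; apply/card_uniqP.
have cR : b < #|R|.
  have := cardsD S [set x in q].
  have := subset_leq_card (subsetIr S [set x in q]); rewrite -/R cq; lia.
have inR x : x \in R -> x \notin p /\ x \notin q.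
  by rewrite !inE => /andP[].
have [z zR] : exists z, z \in R by apply/card_gt0P; lia.
have [zp zq] := inR z zR.
have [A [B [[szA szB uA uB] sAp sBq [zAB sepAB] ends]]] :=
  long_paths_separated t0 pmax qmax tq zp zq.
have notAB w : w \notin p -> w \notin q -> w \notin A ++ B.
  by move=> wp wq; rewrite mem_cat negb_or (contra (@sAp w)) ?(contra (@sBq w)).
(* If [b] holds, [R] has a second vertex and the default [z] is not reached. *)
exists z, (if [pick w in R :\ z] is Some w then w else z), A, B; split=> //.
  split=> //=; rewrite notAB // cat_uniq uA uB andbT /=.
  apply/hasPn=> y /sBq yq; apply/negP=> /sAp yp.
  by have := qS _ yq; rewrite !inE yp.
move=> b1; case: pickP => [w | Rz0]; last first.
  by have := cardsD1 z R; rewrite zR (eq_card0 Rz0) b1 in cR *; lia.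
rewrite in_setD1 => /andP[wz /inR[wp wq]].
have [eA eB] := ends w wp wq.
by rewrite inE negb_or wz notAB.
Qed.

End Separation.

(** * Upper bound: embedding into the complement *)

Lemma path_graph_of_path_in (T : finType) (e : rel T) n p :
  symmetric e -> path_in e setT p -> 0 < n <= size p ->
  contains_subgraph (path_graph n) e.
Proof.
move=> e_sym /and3P[srt unq _] /andP[n0 np].
case: p => [|x0 p] in srt unq np *; first by rewrite leqNgt n0 in np.
have lt (i : 'I_n) : i < size (x0 :: p) := leq_trans (ltn_ord i) np.
exists (fun i : 'I_n => nth x0 (x0 :: p) i); split.
  by move=> i j /eqP; rewrite nth_uniq // => /eqP/val_inj.
have step (i j : 'I_n) : i.+1 == j :> nat ->
    e (nth x0 (x0 :: p) i) (nth x0 (x0 :: p) j).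
  move/eqP=> ij; rewrite -ij; apply: (sortedP x0 srt); rewrite ij; exact: lt.
by move=> i j /orP[/step // | /step]; rewrite e_sym.
Qed.

(* The even cycle positions go to [A], the odd ones to [B]; on an odd cycle the
   last position, which the hub does not see, goes to [w]. *)
Lemma jahangir_embedding (T : finType) (g : rel T) s m (A B : seq T) z w :
  symmetric g -> 1 < s -> 0 < m ->
  size A = (s * m)./2 -> size B = (s * m)./2 -> uniq (z :: A ++ B) ->
  (forall x, x \in A ++ B -> g z x) ->
  (forall x y, x \in A -> y \in B -> g x y) ->
  (odd (s * m) -> [/\ w \notin z :: A ++ B, g w (head z A) & g w (last z B)]) ->
  contains_subgraph (jahangir s m) g.
Proof.
set k := s * m => g_sym s1 m0 szA szB unq gz gAB hw.
have k2 : 1 < k by rewrite /k; nia.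
have sk : s %| k by apply: dvdn_mulr.
have hk := odd_double_half k.
move: unq => /= /andP[zAB]; rewrite cat_uniq => /and3P[uA /hasPn dAB uB].
(* [k./2.*2] is [k - 1] for odd [k], but [k] for even [k], which is no cycle position; so [w] occurs
   only on an odd cycle. *)
pose F (i : nat) := if i == k./2.*2 then w else nth z (if odd i then B else A) i./2.
have Fl i : i < k./2.*2 -> F i = nth z (if odd i then B else A) i./2.
  by rewrite /F => lti; rewrite ltn_eqF.
have Fw : F k./2.*2 = w by rewrite /F eqxx.
have half i : i < k./2.*2 -> i./2 < k./2 by move: (odd_double_half i); lia.
have FAB i : i < k./2.*2 -> F i \in if odd i then B else A.
  by move=> lti; rewrite Fl //; case: ifP => _; rewrite mem_nth ?szA ?szB ?half.
have FAcB i : i < k./2.*2 -> F i \in A ++ B.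
  by move/FAB; rewrite mem_cat; case: ifP => _ ->; rewrite ?orbT.
have last_case i : i < k -> i < k./2.*2 \/ odd k /\ i = k./2.*2 by lia.
have dis x : x \in A -> x \in B -> false.
  by move=> xA /dAB; rewrite /= xA.
have Finj i j : i < k -> j < k -> F i = F j -> i = j.
  move=> ltik ltjk.
  case: (last_case i ltik) => [lti | [ok ->]];
    case: (last_case j ltjk) => [ltj | [ok' ->]] //.
  - have := FAB i lti; have := FAB j ltj; rewrite !Fl //.
    case: ifP => oj; case: ifP => oi.
    + move=> _ _ /eqP; rewrite nth_uniq ?szB ?half // => /eqP.
      by have := odd_double_half i; have := odd_double_half j; rewrite oi oj; lia.
    + by move=> jB iA E; have := dis _ iA; rewrite E => /(_ jB).
    + by move=> jA iB E; have := dis _ jA; rewrite -E => /(_ iB).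
    + move=> _ _ /eqP; rewrite nth_uniq ?szA ?half // => /eqP.
      by have := odd_double_half i; have := odd_double_half j; rewrite oi oj; lia.
  - move=> E; have [+ _ _] := hw ok'.
    by rewrite -Fw -E inE negb_or FAcB // andbF.
  - move=> E; have [+ _ _] := hw ok.
    by rewrite -Fw E inE negb_or FAcB // andbF.
have Fstep i j : i < k -> i.+1 %% k = j -> g (F i) (F j).
  move=> ltik Ej.
  have [[lti1 {}Ej] | [Ei {}Ej]] : (i.+1 < k /\ j = i.+1) \/ (i = k.-1 /\ j = 0).
    case: (ltnP i.+1 k) => ik; first by left; rewrite -Ej modn_small.
    right; have E : i.+1 = k by lia.
    by split; [lia | rewrite -Ej E modnn].
  - have lti : i < k./2.*2 by lia.
    case: (last_case _ lti1) => [lti1' | [ok Ek]].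
      have := FAB i lti; have := FAB _ lti1'; rewrite Ej /=.
      case: (odd i) => /= h1 h2; last exact: gAB.
      by rewrite g_sym; apply: gAB.
    (* On an odd cycle [w] sits between the last entry of [B] and the head of [A]. *)
    have [_ _ gwB] := hw ok.
    rewrite Ej Ek Fw g_sym Fl //.
    have -> : odd i by move: (odd_double k./2); rewrite -Ek /=; case: (odd i).
    have -> : i./2 = (size B).-1 by have := odd_double_half i; rewrite szB; lia.
    by rewrite nth_last.
  - have lt0 : 0 < k./2.*2 by lia.
    case: (last_case i ltik) => [lti | [ok Ek]].
      have := FAB i lti; have := FAB 0 lt0; rewrite Ej /=.
      have -> : odd i by lia.
      by move=> h1 h2; rewrite g_sym; apply: gAB.
    have [_ gwA _] := hw ok.
    by rewrite Ek Ej Fw Fl //= nth0.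
have Fhub j : j < k -> s %| j -> g z (F j).
  move=> ltj sj; case: (last_case j ltj) => [ltj' | [ok Ek]].
    exact/gz/FAcB.
  (* If the hub saw the last position, [s] would divide both [k] and [k - 1]. *)
  have : s %| k - j by apply: dvdn_sub.
  have -> : k - j = 1 by lia.
  by rewrite dvdn1 gtn_eqF.
have Fz j : j < k -> F j <> z.
  move=> ltj; case: (last_case j ltj) => [ltj' | [ok ->]].
    by move=> E; case/negP: zAB; rewrite -E FAcB.
  by rewrite Fw => E; have [/negP[]] := hw ok; rewrite inE E eqxx.
exists (fun x : option 'I_k => if x is Some i then F i else z); split.
  move=> [i|] [j|] //=.
  - by move/(Finj _ _ (ltn_ord i) (ltn_ord j))/val_inj->.
  - by move/(Fz _ (ltn_ord i)).
  - by move/esym/(Fz _ (ltn_ord j)).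
move=> [i|] [j|] //=.
- by case/orP=> /eqP E; [|rewrite g_sym]; apply: Fstep.
- by move/(Fhub _ (ltn_ord i)); rewrite g_sym.
- exact: Fhub.
Qed.

Lemma ramsey_path_jahangir s m n :
  1 < s -> 0 < m -> 4 * (s * m)./2 <= n ->
  ramsey_prop (path_graph n) (jahangir s m) (2 * n - 1 + odd (s * m)).
Proof.
move=> s1 m0 kn f [f_sym f_irr]; set b : bool := odd _; set N := _ + _ in f f_sym f_irr *.
have t0 : 0 < (s * m)./2 by rewrite half_gt0; nia.
case: (boolP [exists p : n.-tuple 'I_N, path_in f setT p]) => [/existsP[p pP] | nop].
  by left; apply: path_graph_of_path_in f_sym pP _; rewrite size_tuple leqnn; lia.
right; have short p : path_in f setT p -> size p < n.
  move=> /and3P[srt unq inT]; rewrite ltnNge; apply/negP=> np.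
  case/existsP: nop; have sz : size (take n p) == n by rewrite size_takel.
  exists (Tuple sz); rewrite /path_in /= take_sorted // take_uniq //=.
  by apply/allP=> x; rewrite inE.
have [z [w [A [B [[szA szB unq] zAB sepAB wAB]]]]] :=
  separated_sets_of_no_path f_sym t0 kn (card_ord N) short.
have complI x y : x != y -> ~~ f x y -> compl_graph f x y.
  by rewrite /compl_graph => -> ->.
have /= /andP[zA unqAB] := unq.
apply: (jahangir_embedding (A := A) (B := B) (z := z) (w := w)) => //.
- by move=> x y; rewrite /compl_graph eq_sym f_sym.
- move=> x xAB; apply: complI (zAB x xAB).
  by apply: contraNneq zA => ->.
- move=> x y xA yB; apply: complI (sepAB x y xA yB).
  move: unqAB; rewrite cat_uniq => /and3P[_ /hasPn/(_ _ yB) yA _].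
  by apply: contraNneq yA => <-.
- move=> /wAB[wzAB wA wB]; split=> //; apply: complI => //.
    apply: contraNneq wzAB => ->; rewrite inE mem_cat.
    by case: (A) szA => [|a A'] /= ?; [lia | rewrite inE eqxx orbT].
  apply: contraNneq wzAB => ->; rewrite inE mem_cat.
  by case: (B) szB => [|a B'] /= ?; [lia | rewrite mem_last !orbT].
Qed.

(** * Lower bound: two cliques and at most one further vertex *)

(** Consecutive blocks of [d] vertices are cliques, the last block perhaps incomplete; one formula
    thus serves every order below the bound. *)
Definition block_graph (d N : nat) : rel 'I_N :=
  fun i j => (i != j) && (i %/ d == j %/ d).

Lemma block_graph_simple d N : simple_graph (@block_graph d N).
Proof.
split=> [x y | x]; last by rewrite /block_graph eqxx.
by rewrite /block_graph eq_sym [X in _ && X]eq_sym.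
Qed.

(** A path stays in one block, where residues modulo [d] tell its vertices apart. *)
Lemma block_graph_no_path d N n :
  0 < d < n -> ~ contains_subgraph (path_graph n) (@block_graph d N).
Proof.
case/andP=> d0 dn [phi [phi_inj phi_path]].
have n0 : 0 < n by lia.
have same i (lti : i < n) : phi (Ordinal lti) %/ d = phi (Ordinal n0) %/ d.
  elim: i lti => [|i IH] lti; first by congr (phi _ %/ d); apply: val_inj.
  rewrite -(IH (ltnW lti)).
  have /phi_path/andP[_ /eqP//] : path_graph n (Ordinal lti) (Ordinal (ltnW lti)).
  by rewrite /path_graph /= eqxx orbT.
pose psi (i : 'I_n) : 'I_d := Ordinal (ltn_pmod (phi i) d0).
have /leq_card : injective psi; last by rewrite !card_ord leqNgt dn.
move=> [i lti] [j ltj] [E]; apply/phi_inj/val_inj.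
by rewrite /= (divn_eq (phi (Ordinal lti)) d) (divn_eq (phi (Ordinal ltj)) d) !same E.
Qed.

(** * Partial two-colourings of the Jahangir graph, with [U] the uncoloured vertices, and its odd
    cycles *)

Section CycleColouring.

Variables (s m : nat).
Hypothesis k0 : 0 < s * m.

(** Reducing the index lets a walk along the rim pass its last vertex. *)
Definition cycle_vertex i : option 'I_(s * m) := Some (Ordinal (ltn_pmod i k0)).

Variables (U : pred (option 'I_(s * m))) (col : option 'I_(s * m) -> bool).
Hypothesis col_proper :
  forall x y, ~~ U x -> ~~ U y -> jahangir s m x y -> col x != col y.

Lemma cycle_colour_alternates a l :
  (forall i, i <= l -> ~~ U (cycle_vertex (a + i))) ->
  col (cycle_vertex (a + l)) = col (cycle_vertex a) (+) odd l.
Proof.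
elim: l => [|l IH] nU; first by rewrite addn0 addbF.
have := col_proper (nU l (leqnSn l)) (nU l.+1 (leqnn _)).
rewrite IH => [|i il]; last by apply: nU; apply: leqW.
rewrite /= -addn1 modnDml addn1 addnS eqxx => /(_ isT).
by case: (col _); case: (col _); case: (odd l).
Qed.

(* The hub and [s + 1] consecutive cycle vertices form an odd cycle. *)
Lemma sector_meets_uncoloured q :
  odd s -> ~~ U None -> exists2 i, i <= s & U (cycle_vertex (q * s + i)).
Proof.
move=> s_odd U0; case: (boolP [exists i : 'I_s.+1, U (cycle_vertex (q * s + i))]).
  by case/existsP=> i Ui; exists i; rewrite // -ltnS.
move/existsPn=> nU; exfalso.
have {}nU i : i <= s -> ~~ U (cycle_vertex (q * s + i)).
  by move=> lti; apply: nU (Ordinal (lti : i < s.+1)).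
have := cycle_colour_alternates nU; rewrite s_odd.
(* The hub sees both ends of the sector, as [s] divides their indices even after reduction; so they
   share a colour, while odd [s] makes them differ. *)
have hub i : i <= s -> s %| i -> col None != col (cycle_vertex (q * s + i)).
  move=> lti si; apply: col_proper; rewrite ?nU //=.
  by rewrite /dvdn modn_dvdm ?dvdn_mulr // modnMDl.
have := hub s (leqnn s) (dvdnn s); have := hub 0 (leq0n s) (dvdn0 s).
rewrite addn0.
by case: (col None); case: (col _); case: (col _).
Qed.

(** A full turn round an odd rim would flip the colour of its starting vertex. *)
Lemma odd_cycle_meets_uncoloured :
  odd (s * m) -> exists i, U (cycle_vertex i).
Proof.
move=> k_odd.
case: (boolP [exists i : 'I_(s * m).+1, U (cycle_vertex i)]).
  by case/existsP=> i Ui; exists i.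
move/existsPn=> nU; exfalso.
have := @cycle_colour_alternates 0 (s * m); rewrite k_odd.
have -> : cycle_vertex (0 + s * m) = cycle_vertex 0.
  by congr Some; apply: val_inj; rewrite /= modnn mod0n.
have {}nU i : i <= s * m -> ~~ U (cycle_vertex (0 + i)).
  by move=> lti; apply: nU (Ordinal (lti : i < (s * m).+1)).
by move=> /(_ nU); case: (col _).
Qed.

End CycleColouring.

(** In the complement of the cliques, the block number properly colours the vertices below [2 * d].
    Only vertex [2 * d] can be uncoloured, and it exists only for odd [s * m]. *)
Lemma not_ramsey_path_jahangir s m n M :
  odd s -> 2 < s -> 1 < m -> 1 < n -> M < 2 * n - 1 + odd (s * m) ->
  ~ ramsey_prop (path_graph n) (jahangir s m) M.
Proof.
move=> s_odd s2 m1 n1 ltM ram; have k0 : 0 < s * m by nia.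
set d := n.-1.
have [|] := ram _ (@block_graph_simple d M).
  by apply: block_graph_no_path; rewrite /d; lia.
case=> phi [phi_inj phi_edge].
pose U x := 2 * d <= phi x; pose col x := d <= phi x.
have proper x y : ~~ U x -> ~~ U y -> jahangir s m x y -> col x != col y.
  rewrite /U -!ltnNge => Ux Uy /phi_edge /andP[nxy].
  rewrite /block_graph nxy /= /col; apply: contra => /eqP E.
  have quot u : u < 2 * d -> u %/ d = (d <= u).
    move=> ltu; case: leqP => du; last by rewrite divn_small.
    by rewrite -(subnK du) divnDr ?divnn ?divn_small //; lia.
  by rewrite !quot // E.
have Uval x : U x -> odd (s * m) /\ phi x = 2 * d :> nat.
  rewrite /U => Ux; have := ltn_ord (phi x); rewrite /d in Ux *.
  by move: ltM; case: odd; lia.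
have Ueq x y : U x -> U y -> x = y.
  by move=> /Uval[_ Ex] /Uval[_ Ey]; apply/phi_inj/val_inj; rewrite /= Ex Ey.
have sector := sector_meets_uncoloured k0 proper.
(* Were the hub the one uncoloured vertex, the odd rim would be properly two-coloured. *)
have U0 : ~~ U None.
  apply/negP=> U0; have [k_odd _] := Uval _ U0.
  by have [i Ui] := odd_cycle_meets_uncoloured k0 proper k_odd; have := Ueq _ _ Ui U0.
have [i0 i0s U1] := sector 0 s_odd U0.
have [i1 i1s U2] := sector 1 s_odd U0.
have [i2 i2s U3] := sector 2 s_odd U0.
have [k_odd _] := Uval _ U1.
have m3 : 2 < m.
  by move: k_odd; rewrite oddM s_odd /=; case: (m) m1 => [|[|[]]].
(* Sectors 0, 1 and 2 would share the uncoloured vertex. The first two meet only at position [s],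
   which is not in the third, even if [3 * s] wraps round to 0. *)
have [] := Ueq _ _ U1 U2; have [] := Ueq _ _ U1 U3.
have k3 : 3 * s <= s * m by rewrite mulnC leq_mul2l m3 orbT.
rewrite modn_small; last by lia.
move=> E2; rewrite modn_small; last by lia.
move: E2; case: (ltnP (2 * s + i2) (s * m)) => [lt2 | ge2].
  by rewrite modn_small //; lia.
have -> : 2 * s + i2 = s * m by lia.
by rewrite modnn; lia.
Qed.

(** * The Ramsey number for both parities of [m] *)

Lemma is_ramsey_number_path_jahangir s m n :
  odd s -> 2 < s -> 1 < m -> 4 * (s * m)./2 <= n ->
  is_ramsey_number (path_graph n) (jahangir s m) (2 * n - 1 + odd (s * m)).
Proof.
move=> s_odd s2 m1 kn; split; first by apply: ramsey_path_jahangir; lia.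
move=> M ram; rewrite leqNgt; apply/negP=> ltM.
have : 1 < n by nia.
by move=> n1; apply: not_ramsey_path_jahangir ltM ram.
Qed.

Theorem theorem2 (s : nat) (hs3 : 3 <= s) (hsodd : odd s) :
  (forall m n : nat, 2 <= m -> ~~ odd m -> (s * m) %/ 2 * (s * m - 2) <= n ->
     is_ramsey_number (path_graph n) (jahangir s m) (2 * n - 1)) /\
  (forall m n : nat, 3 <= m -> odd m -> (s * m - 1) %/ 2 * (s * m - 1) <= n ->
     is_ramsey_number (path_graph n) (jahangir s m) (2 * n)).
Proof.
split=> m n hm m_odd hn.
  have k_even : odd (s * m) = false by rewrite oddM (negPf m_odd) andbF.
  have -> : 2 * n - 1 = 2 * n - 1 + odd (s * m) by rewrite k_even addn0.
  (* Hence the factor [s * m - 2] is at least 4, and the bound on [n] yields the required four times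
     half of [s * m]. *)
  have k6 : 6 <= s * m by apply: (@leq_mul 3 2).
  apply: is_ramsey_number_path_jahangir => //.
  by apply: leq_trans hn; rewrite divn2 mulnC leq_mul2l; lia.
have k_odd : odd (s * m) by rewrite oddM hsodd m_odd.
have k9 : 9 <= s * m by apply: (@leq_mul 3 3).
have half : (s * m - 1) %/ 2 = (s * m)./2 by lia.
have kn : 4 * (s * m)./2 <= n.
  by apply: leq_trans hn; rewrite half mulnC leq_mul2l; lia.
have -> : 2 * n = 2 * n - 1 + odd (s * m) by rewrite k_odd; lia.
by apply: is_ramsey_number_path_jahangir => //; lia.
Qed.
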